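(* Let $\mu,\lambda$ be two infinite cardinals with $\mathrm{cf}(\mu)=\mu<\lambda$. Suppose that $\mu^+$ is a $\lambda$-revision cardinal. Then: (1) $\clubsuit^{cof/\mu^+,\ast}_{\lambda^+}[NS_{\lambda^+}|E^{\lambda^+}_\mu]$ holds. (2) If $d(\mu,\mu)\leq\lambda$, then $\clubsuit^\ast_{\lambda^+}[NS_{\lambda^+}|E^{\lambda^+}_\mu]$ holds. (3) If $d(\mu,\mu)\leq\lambda$ and $2^\lambda=\lambda^+$, then $\diamondsuit^\ast_{\lambda^+}[NS_{\lambda^+}|E^{\lambda^+}_\mu]$ holds.
   Context: For a set $S$ and a cardinal $\tau$, $P_\tau(S)=\{x\subseteq S : |x|<\tau\}$ and $[S]^\tau=\{x\subseteq S:|x|=\tau\}$. For cardinals $\rho_1,\rho_2,\rho_3,\rho_4$ with $\rho_1^+\geq\rho_2$, $\rho_2^+\geq\rho_3\geq\omega$ and $\rho_3\geq\rho_4\geq 2$, the covering number $\mathrm{cov}(\rho_1,\rho_2,\rho_3,\rho_4)$ is the least cardinality of any $X\subseteq P_{\rho_2}(\rho_1)$ such that for any $b\in P_{\rho_3}(\rho_1)$ there is $Q\in P_{\rho_4}(X)$ with $b\subseteq\bigcup Q$. For infinite cardinals $\chi\leq\lambda$, $\chi$ is a $\lambda$-revision cardinal if $\mathrm{cov}(\lambda,\chi,\chi,\sigma)\leq\lambda$ for some cardinal $\sigma<\chi$ (with $\sigma\geq 2$). For infinite cardinals $\rho\leq\lambda$, the density number $d(\rho,\lambda)$ is the least cardinality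 of any $Q\subseteq[\lambda]^\rho$ such that for any $b\in[\lambda]^\rho$ there is $q\in Q$ with $q\subseteq b$. Let $\tau$ be a regular uncountable cardinal. $NS_\tau$ is the nonstationary ideal on $\tau$. For a regular cardinal $\mu$, $E^\tau_\mu=\{\alpha<\tau:\mathrm{cf}(\alpha)=\mu\}$. For an ideal $J$ on $\tau$, $J^\ast$ is the dual filter, and for $S\subseteq\tau$, $J|S=\{X\subseteq\tau: X\cap S\in J\}$. Let $J$ be a $\tau$-complete ideal on $\tau$. For a cardinal $\eta<\tau$, $\clubsuit^{cof/\eta,\ast}_\tau[J]$ asserts the existence of $B^i_\delta\in P_\eta(\delta)$ for $i<\delta<\tau$ such that for any $A\in[\tau]^\tau$, $\{\delta<\tau:\exists i<\delta\,(\sup(A\cap B^i_\delta)=\delta)\}\in J^\ast$. $\clubsuit^\ast_\tau[J]$ asserts the existence of $s^i_\alpha\subseteq\alpha$ with $\sup s^i_\alpha=\alpha$, for each infinite limit ordinal $\alpha<\tau$ and each $i<\alpha$, such that $\{\alpha<\tau:\exists i<\alpha\,(s^i_\alpha\subseteq A)\}\in J^\ast$ for all $A\in[\tau]^\tau$ (where only infinite limit $\alpha$ are considered in this set). $\diamondsuit^\ast_\tau[J]$ asserts the existence of $t^i_\alpha\subseteq\alpha$ for $i<\alpha<\tau$ such that $\{\alpha<\tau:\exists i<\alpha\,(t^i_\alpha=A\cap\alpha)\}\in J^\ast$ for every $A\subseteq\tau$. *)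

(* Defs.v *)
From HB Require Import structures.
From mathcomp Require Import all_boot all_order.
From mathcomp Require Import boolp classical_sets functions cardinality.

Set Implicit Arguments.
Unset Strict Implicit.
Unset Printing Implicit Defensive.

Import Order.TTheory.

Local Open Scope classical_set_scope.
Local Open Scope card_scope.
Local Open Scope order_scope.

(* Ordinals are isomorphism classes of (small) well-ordered types. *)

Record wellorder : Type := WellOrder {
  wcar :> Type;
  wlt : wcar -> wcar -> Prop;
  wlt_trans : forall x y z, wlt x y -> wlt y z -> wlt x z;
  wlt_total : forall x y, wlt x y \/ x = y \/ wlt y x;
  wlt_wf : well_founded wlt }.

Definition wiso (v w : wellorder) : Prop :=
  exists f : v -> w, bijective f /\ forall x y, wlt x y <-> wlt (f x) (f y).

(* v is isomorphic to the proper initial segment of w below y *)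
Definition wiso_below (v w : wellorder) (y : w) : Prop :=
  exists f : v -> w, (forall x x', wlt x x' <-> wlt (f x) (f x')) /\
    forall z, wlt z y <-> exists x, f x = z.

Record Ord : Type := MkOrd {
  ord_class : set wellorder;
  ord_classP : exists w, ord_class = [set v | wiso v w] }.

Definition olt (a b : Ord) : Prop :=
  exists (v w : wellorder) (y : w), [/\ ord_class a v, ord_class b w & wiso_below v y].

Section WellOrderTheory.

Lemma wlt_irr (w : wellorder) (x : w) : ~ wlt x x.
Proof. by elim: {x}(wlt_wf x) => x _ IH xx; exact: (IH x xx). Qed.

Lemma wlt_inj (v w : wellorder) (f : v -> w) :
  (forall x x', wlt x x' <-> wlt (f x) (f x')) -> injective f.
Proof.
move=> fm x x' e; case: (wlt_total x x') => [|[//|]] /fm;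
  by rewrite e => /wlt_irr.
Qed.

Lemma wiso_refl w : wiso w w.
Proof. by exists id; split => //; exists id. Qed.

Lemma wiso_sym v w : wiso v w -> wiso w v.
Proof.
case=> f [[g fK gK] fm]; exists g; split; first by exists f.
by move=> x y; rewrite fm !gK.
Qed.

Lemma wiso_trans u v w : wiso u v -> wiso v w -> wiso u w.
Proof.
move=> [f [bf fm]] [g [bg gm]]; exists (g \o f); split; first exact: bij_comp.
by move=> x y; rewrite fm gm.
Qed.

Lemma bij_of (v w : wellorder) (f : v -> w) :
  injective f -> (forall z, exists x, f x = z) -> bijective f.
Proof.
move=> fi fs; pose g z := projT1 (cid (fs z)).
have gK : cancel g f by move=> z; rewrite /g; case: cid.
by exists g => // x; apply: fi; rewrite gK.
Qed.

Lemma wiso_below_comp (u v w : wellorder) (y : v) (z : w) :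
  wiso_below u y -> wiso_below v z ->
  exists2 z' : w, wlt z' z & wiso_below u z'.
Proof.
move=> [f [fm fr]] [g [gm gr]]; exists (g y); first by apply/gr; exists y.
exists (g \o f); split; first by move=> x x'; rewrite fm gm.
move=> t; split=> [ty|[x <-]]; last by apply/gm/fr; exists x.
have /gr[s st] : wlt t z.
  by apply: wlt_trans ty _; apply/gr; exists y.
by move: ty; rewrite -st => /gm/fr[x xs]; exists x; rewrite /= xs.
Qed.

Lemma wiso_below_isol (u v w : wellorder) (z : w) :
  wiso u v -> wiso_below v z -> wiso_below u z.
Proof.
move=> [f [[g fK gK] fm]] [h [hm hr]]; exists (h \o f).
split; first by move=> x x'; rewrite fm hm.
move=> t; split=> [/hr[x <-]|[x <-]]; last by apply/hr; exists (f x).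
by exists (g x); rewrite /= gK.
Qed.

Lemma wiso_below_isor (u v w : wellorder) (y : v) :
  wiso_below u y -> wiso v w -> exists z : w, wiso_below u z.
Proof.
move=> [f [fm fr]] [g [[h gK hK] gm]]; exists (g y), (g \o f).
split; first by move=> x x'; rewrite fm gm.
move=> t; rewrite -[t]hK -gm fr; split=> -[x /= xt]; exists x.
  by rewrite xt.
exact: can_inj gK _ _ xt.
Qed.

Definition wseg_lt (w : wellorder) (x : w) (y z : {y : w | wlt y x}) : Prop :=
  wlt (sval y) (sval z).

Lemma wseg_trans (w : wellorder) (x : w) (a b c : {y : w | wlt y x}) :
  wseg_lt a b -> wseg_lt b c -> wseg_lt a c.
Proof. exact: wlt_trans. Qed.

Lemma wseg_total (w : wellorder) (x : w) (a b : {y : w | wlt y x}) :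
  wseg_lt a b \/ a = b \/ wseg_lt b a.
Proof.
case: a b => [a ax] [b bx]; rewrite /wseg_lt /=.
case: (wlt_total a b) => [|[ab|]]; [by left| |by right; right].
by right; left; exact: eq_exist.
Qed.

Lemma wseg_wf (w : wellorder) (x : w) : well_founded (@wseg_lt w x).
Proof.
move=> [a ax]; elim: {a}(wlt_wf a) ax => a _ IH ax.
by constructor=> -[b bx] ba; exact: IH.
Qed.

Definition wseg (w : wellorder) (x : w) : wellorder :=
  WellOrder (@wseg_trans w x) (@wseg_total w x) (@wseg_wf w x).

Lemma wseg_below (w : wellorder) (x : w) : wiso_below (wseg x) x.
Proof.
exists sval; split=> // z; split=> [zx|[[y yx] <-]//].
by exists (exist _ z zx).
Qed.

Lemma wiso_below_unique (u v w : wellorder) (z : w) :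
  wiso_below u z -> wiso_below v z -> wiso u v.
Proof.
move=> [f [fm fr]] [g [gm gr]].
have h x : exists y, g y = f x by apply/gr/fr; exists x.
pose k x := projT1 (cid (h x)).
have kE x : g (k x) = f x by rewrite /k; case: cid.
exists k; split; last by move=> x x'; rewrite fm gm !kE.
apply: bij_of => [x x' e|y]; first by apply: (wlt_inj fm); rewrite -!kE e.
have /fr[x xy] : wlt (g y) z by apply/gr; exists y.
by exists x; apply: (wlt_inj gm); rewrite kE.
Qed.

End WellOrderTheory.

Section OrdTheory.

Lemma Ord_ext a b : ord_class a = ord_class b -> a = b.
Proof.
by case: a b => [A hA] [B hB] /= AB; case: _ / AB hB => hB;
  congr MkOrd; exact: Prop_irrelevance.
Qed.

Definition ord_of (w : wellorder) : Ord :=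
  MkOrd (ex_intro (fun w' => [set v | wiso v w] = [set v | wiso v w']) w erefl).

Lemma ord_ofE a w : ord_class a w -> a = ord_of w.
Proof.
case: a => A [w' AE] /=; rewrite {1}AE /= => ww'.
apply: Ord_ext => /=; rewrite AE; apply/seteqP; split=> v /= vw.
  exact: wiso_trans vw (wiso_sym ww').
exact: wiso_trans vw ww'.
Qed.

Lemma ord_rep a : exists w, a = ord_of w.
Proof.
case: (ord_classP a) => w aw; exists w; apply: ord_ofE.
by rewrite aw; exact: wiso_refl.
Qed.

Lemma ord_of_eq v w : wiso v w -> ord_of v = ord_of w.
Proof. by move=> vw; rewrite -(@ord_ofE (ord_of w) v vw). Qed.

Lemma olt_ofP v w : olt (ord_of v) (ord_of w) <-> exists y : w, wiso_below v y.
Proof.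
split=> [[v' [w' [y [/= vv' ww' h]]]]|[y h]].
  by have [y' h'] := wiso_below_isor h ww'; exists y';
    exact: wiso_below_isol (wiso_sym vv') h'.
by exists v, w, y; split=> //; exact: wiso_refl.
Qed.

Lemma olt_segP a w : olt a (ord_of w) <-> exists y : w, a = ord_of (wseg y).
Proof.
have [v ->] := ord_rep a; rewrite olt_ofP; split=> -[y h]; exists y.
  exact/ord_of_eq/(wiso_below_unique h)/wseg_below.
have : ord_class (ord_of (wseg y)) v by rewrite -h /=; exact: wiso_refl.
by move=> /wiso_below_isol; apply; exact: wseg_below.
Qed.

Lemma olt_wseg (w : wellorder) (x y : w) : wlt x y -> olt (ord_of (wseg x)) (ord_of (wseg y)).
Proof.
move=> xy; apply/olt_ofP; exists (exist _ x xy).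
exists (fun z : wseg x => exist _ (sval z) (wlt_trans (svalP z) xy)).
split=> // -[z zy]; split=> [zx|[[t tx] <-]]; last exact: tx.
by exists (exist _ z zx); exact: eq_exist.
Qed.

Lemma olt_trans a b c : olt a b -> olt b c -> olt a c.
Proof.
have [u ->] := ord_rep a; have [v ->] := ord_rep b; have [w ->] := ord_rep c.
move=> /olt_ofP[y uy] /olt_ofP[z vz].
by apply/olt_ofP; have [z' _ h] := wiso_below_comp uy vz; exists z'.
Qed.

Lemma olt_wf : well_founded olt.
Proof.
move=> a; have [w ->] := ord_rep a.
have segacc (x : w) : Acc olt (ord_of (wseg x)).
  elim: {x}(wlt_wf x) => x _ IH; constructor=> b /olt_segP[[y yx] ->].
  suff -> : ord_of (wseg (exist _ y yx : wseg x)) = ord_of (wseg y) by exact: IH.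
  apply/ord_of_eq/(wiso_below_unique (z := y)); last exact: wseg_below.
  have [y' y'y h] :=
    wiso_below_comp (wseg_below (exist _ y yx : wseg x)) (wseg_below x).
  exists (fun z => sval (sval z)); split=> // z.
  split=> [zy|[[[t tx] ty] <-]//].
  by exists (exist _ (exist _ z (wlt_trans zy yx)) zy).
by constructor=> b /olt_segP[y ->].
Qed.

Lemma olt_irr a : ~ olt a a.
Proof. by elim: {a}(olt_wf a) => a _ IH aa; exact: (IH a aa). Qed.

Lemma wlt_segP (w : wellorder) (x y : w) :
  wlt x y <-> olt (ord_of (wseg x)) (ord_of (wseg y)).
Proof.
split=> [|xy]; first exact: olt_wseg.
case: (wlt_total x y) => [//|[e|/olt_wseg yx]].
  by move: xy; rewrite e => /olt_irr.
by case: (olt_irr (olt_trans xy yx)).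
Qed.

Lemma olt_ext a b : (forall c, olt c a <-> olt c b) -> a = b.
Proof.
have [v ->] := ord_rep a; have [w ->] := ord_rep b => vw.
have h (x : v) : exists y : w, ord_of (wseg x) = ord_of (wseg y).
  by apply/olt_segP/vw/olt_segP; exists x.
pose k x := projT1 (cid (h x)).
have kE x : ord_of (wseg x) = ord_of (wseg (k x)) by rewrite /k; case: cid.
apply: ord_of_eq; exists k.
have km x y : wlt x y <-> wlt (k x) (k y) by rewrite !wlt_segP !kE.
split=> //; apply: bij_of => [|y]; first exact: wlt_inj.
have /vw/olt_segP[x yx] : olt (ord_of (wseg y)) (ord_of w).
  by apply/olt_segP; exists y.
exists x; case: (wlt_total (k x) y) => [|[//|]] /wlt_segP;
  by rewrite -kE yx => /olt_irr.
Qed.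

Lemma olt_total a b : olt a b \/ a = b \/ olt b a.
Proof.
elim: {a}(olt_wf a) b => a _ IHa b.
elim: {b}(olt_wf b) => b _ IHb.
have [[b' b'b [->|ab']]|nb] :=
    pselect (exists2 b', olt b' b & a = b' \/ olt a b').
- by left.
- by left; exact: olt_trans ab' b'b.
have [[a' a'a [->|ba']]|na] :=
    pselect (exists2 a', olt a' a & b = a' \/ olt b a').
- by right; right.
- by right; right; exact: olt_trans ba' a'a.
right; left; apply: olt_ext => c; split=> [ca|cb].
  case: (IHa c ca b) => [//|[e|bc]]; exfalso; apply: na; exists c => //.
    by left.
  by right.
case: (IHb c cb) => [ac|[e|//]]; exfalso; apply: nb; exists c => //.
  by right.
by left.
Qed.

End OrdTheory.

HB.instance Definition _ := gen_eqMixin Ord.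
HB.instance Definition _ := gen_choiceMixin Ord.

Definition Ord_lt (a b : Ord) : bool := `[< olt a b >].
Definition Ord_le (a b : Ord) : bool := (a == b) || Ord_lt a b.

Fact Ord_lt_def a b : Ord_lt a b = (b != a) && Ord_le a b.
Proof.
rewrite /Ord_le; apply/idP/andP => [ab|[ba /orP[/eqP e|//]]].
  split; last by rewrite ab orbT.
  by apply/eqP => e; move: ab; rewrite e => /asboolP/olt_irr.
by rewrite e eqxx in ba.
Qed.

Fact Ord_le_refl : reflexive Ord_le.
Proof. by move=> a; rewrite /Ord_le eqxx. Qed.

Fact Ord_le_anti : antisymmetric Ord_le.
Proof.
move=> a b /andP[/orP[/eqP//|/asboolP ab] /orP[/eqP//|/asboolP ba]].
by case: (olt_irr (olt_trans ab ba)).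
Qed.

Fact Ord_le_trans : transitive Ord_le.
Proof.
move=> b a c /orP[/eqP->//|/asboolP ab] /orP[/eqP<-|/asboolP bc];
  apply/orP; right; apply/asboolP => //; exact: olt_trans bc.
Qed.

Fact Ord_le_total : total Ord_le.
Proof.
move=> a b; rewrite /Ord_le /Ord_lt.
case: (olt_total a b) => [/asboolP->|[->|/asboolP->]]; rewrite ?eqxx ?orbT//.
Qed.

Fact Ord_display : Order.disp_t. Proof. exact: (Order.Disp tt tt). Qed.

HB.instance Definition _ := Order.isPOrder.Build Ord_display Ord
  Ord_lt_def Ord_le_refl Ord_le_anti Ord_le_trans.
HB.instance Definition _ :=
  Order.POrder_isTotal.Build Ord_display Ord Ord_le_total.

Lemma Ord_wf : well_founded (fun a b : Ord => a < b).
Proof.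
move=> a; elim: {a}(olt_wf a) => a _ IH.
by constructor=> b /asboolP; exact: IH.
Qed.

Lemma wlt_False_wf : well_founded (fun _ _ : False => False).
Proof. by case. Qed.

Definition zero_ord : Ord := ord_of (@WellOrder False (fun _ _ => False)
  (fun x _ _ _ _ => x) (fun x _ => False_ind _ x) wlt_False_wf).

(* An ordinal, as a set, is the set of the smaller ordinals. *)
Definition seg (a : Ord) : set Ord := [set b | b < a].

(* zero_ord is a junk value for the empty set *)
Definition least (P : set Ord) : Ord :=
  xget zero_ord [set a | P a /\ forall b, P b -> a <= b].

Lemma leastP (P : set Ord) : P !=set0 ->
  P (least P) /\ forall b, P b -> least P <= b.
Proof.
move=> [a Pa]; apply: (@xgetPex _ zero_ord [set a | P a /\ forall b, P b -> a <= b]).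
elim: {a}(Ord_wf a) Pa => a _ IH Pa.
have [[b ba Pb]|na] := pselect (exists2 b, b < a & P b); first exact: IH Pb.
by exists a; split=> // b Pb; rewrite leNgt; apply/negP => ba; apply: na; exists b.
Qed.

(* Meaningful for A equipotent with some ordinal; every set of ordinals (or set
   of sets of ordinals) bounded in some seg a is. *)
Definition ocard (T : Type) (A : set T) : Ord := least [set a | seg a #= A].

Definition is_cardinal (a : Ord) : Prop := ocard (seg a) = a.

Definition infinite_cardinal (a : Ord) : Prop :=
  is_cardinal a /\ infinite_set (seg a).

Definition succ_card (a : Ord) : Ord := least [set b | is_cardinal b /\ a < b].

Definition pow2 (a : Ord) : Ord := ocard [set x : set Ord | x `<=` seg a].

(* P_tau(S) and [S]^tau *)
Definition subsets_lt (T : Type) (tau : Ord) (S : set T) : set (set T) :=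
  [set x | x `<=` S /\ ocard x < tau].

Definition subsets_eq (T : Type) (tau : Ord) (S : set T) : set (set T) :=
  [set x | x `<=` S /\ ocard x = tau].

(* The sup of the empty set is zero_ord. *)
Definition osup (x : set Ord) : Ord := supremum zero_ord x.

Definition cofinal_in (a : Ord) (x : set Ord) : Prop :=
  x `<=` seg a /\ forall b, b < a -> exists2 c, x c & b <= c.

Definition cf (a : Ord) : Ord :=
  least [set k | exists2 x, cofinal_in a x & ocard x = k].

Definition infinite_limit (a : Ord) : Prop :=
  zero_ord < a /\ forall b, b < a -> exists2 c, b < c & c < a.

(* Used for r2 <= r1^+, r3 <= r2^+, r3 infinite and 2 <= r4 <= r3. *)
Definition cov (r1 r2 r3 r4 : Ord) : Ord :=
  least [set k | exists X : set (set Ord),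
    [/\ X `<=` subsets_lt r2 (seg r1),
        forall b, subsets_lt r3 (seg r1) b ->
          exists2 Q, subsets_lt r4 X Q & b `<=` \bigcup_(q in Q) q
      & ocard X = k]].

Definition revision_cardinal (lam chi : Ord) : Prop :=
  [/\ infinite_cardinal chi, infinite_cardinal lam, chi <= lam &
      exists sigma, [/\ is_cardinal sigma, ocard `I_2 <= sigma, sigma < chi &
                        cov lam chi chi sigma <= lam]].

Definition density (rho lam : Ord) : Ord :=
  least [set k | exists Q : set (set Ord),
    [/\ Q `<=` subsets_eq rho (seg lam),
        forall b, subsets_eq rho (seg lam) b -> exists2 q, Q q & q `<=` b
      & ocard Q = k]].

Definition club (tau : Ord) (C : set Ord) : Prop :=
  cofinal_in tau C /\
  forall x, x `<=` C -> x !=set0 -> osup x < tau -> C (osup x).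

Definition NS (tau : Ord) : set (set Ord) :=
  [set X | X `<=` seg tau /\ exists2 C, club tau C & X `&` C = set0].

Definition Ecf (tau mu : Ord) : set Ord := [set a | a < tau /\ cf a = mu].

Definition ideal_restr (tau : Ord) (J : set (set Ord)) (S : set Ord) :
    set (set Ord) :=
  [set X | X `<=` seg tau /\ J (X `&` S)].

Definition dual_filter (tau : Ord) (J : set (set Ord)) : set (set Ord) :=
  [set X | X `<=` seg tau /\ J (seg tau `\` X)].

(* In the three principles below, only the values at i < d < tau of the
   sequences of sets are relevant. *)
Definition clubsuit_cof (tau eta : Ord) (J : set (set Ord)) : Prop :=
  exists B : Ord -> Ord -> set Ord,
    (forall i d, i < d -> d < tau -> subsets_lt eta (seg d) (B d i)) /\
    forall A, subsets_eq tau (seg tau) A ->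
      dual_filter tau J
        [set d | d < tau /\ exists2 i, i < d & osup (A `&` B d i) = d].

Definition clubsuit_star (tau : Ord) (J : set (set Ord)) : Prop :=
  exists s : Ord -> Ord -> set Ord,
    (forall i a, i < a -> a < tau -> infinite_limit a ->
      s a i `<=` seg a /\ osup (s a i) = a) /\
    forall A, subsets_eq tau (seg tau) A ->
      dual_filter tau J
        [set a | [/\ a < tau, infinite_limit a &
                     exists2 i, i < a & s a i `<=` A]].

Definition diamond_star (tau : Ord) (J : set (set Ord)) : Prop :=
  exists t : Ord -> Ord -> set Ord,
    (forall i a, i < a -> a < tau -> t a i `<=` seg a) /\
    forall A, A `<=` seg tau ->
      dual_filter tau J
        [set a | a < tau /\ exists2 i, i < a & t a i = A `&` seg a].

(* Main.v *)
From HB Require Import structures.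
Require Import Defs.
From mathcomp Require Import all_boot all_order.
From mathcomp Require Import boolp classical_sets functions cardinality.
From mathcomp Require wochoice.

(** Write tau for the successor of lam. For lam < d < tau fix a surjection g d
    from lam onto d, and let X be a family of at most lam subsets of lam, each
    of size at most mu, such that every subset of lam of size at most mu lies
    in the union of fewer than mu members of X: the revision hypothesis gives
    one, since a cardinal below the successor of mu is at most mu.

    The first principle is witnessed by the sets g d @` x, x in X. Let d have
    cofinality mu and be a limit of A. A cofinal subset y of A below d of size
    mu pulls back to lam, so it is covered by fewer than mu = cf d sets
    g d @` x, and one of these must already meet y cofinally
    ([cofinal_bigcup], [covering_guess]). The limits of A form a club.

    For the second, enumerate each x in X by mu, so that A meets cofinally the
    range of some u : mu -> d. The indices of A at which u exceeds all its
    earlier values in A form a subset R of mu of size mu, and u is increasing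
    on R. A set q of size mu inside R is unbounded in mu, hence u @` q is a
    cofinal subset of A. Taking q in a dense family of at most lam subsets of
    mu leaves lam * lam = lam candidates ([density_guess]).

    For the third, 2^lam = tau lets the ordinals below tau code all pairs of an
    ordinal a < tau and a subset of a. Apply the second principle to the set of
    codes of the pairs (a, A below a): a cofinal set of such codes below d
    determines A below d, for all d in a club
    ([diamond_star_of_clubsuit_star]).

    Two facts of cardinal arithmetic are needed: lam * lam = lam
    ([card_setX_self_le]) and the regularity of tau ([succ_card_regular]). *)

Set Implicit Arguments.
Unset Strict Implicit.
Unset Printing Implicit Defensive.

Import Order.TTheory.

Local Open Scope classical_set_scope.
Local Open Scope card_scope.
Local Open Scope order_scope.

(** * Cardinals of small sets *)

HB.instance Definition _ := isPointed.Build Ord zero_ord.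

Lemma Ord_ltP (a b : Ord) : reflect (olt a b) (a < b).
Proof. exact: asboolP. Qed.

Lemma card_seg (w : wellorder) : seg (ord_of w) #= [set: w].
Proof.
have <- : (fun x : w => ord_of (wseg x)) @` [set: w] = seg (ord_of w).
  apply/seteqP; split=> [_ [x _ <-]|b /Ord_ltP/olt_segP[x ->]]; last by exists x.
  by apply/Ord_ltP/olt_segP; exists x.
apply: inj_card_eq => x y _ _ e.
by case: (wlt_total x y) => [|[//|]] /wlt_segP; rewrite e => /olt_irr.
Qed.

(** The type ranges over all universes here, whereas equality types live in a
    universe above that of the carriers of well-orders. *)
Lemma well_orderable (T : Type) : exists R : T -> T -> bool, wochoice.well_order R.
Proof.
by elim/Peq: T => T; have [R] := wochoice.well_ordering_principle T; exists R.
Qed.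

(** By the well-ordering theorem; for non-strict R the strict order is the
    negation of the converse of R. *)
Lemma small_type (T : Type) : exists a, seg a #= [set: T].
Proof.
have [R Rwo] := well_orderable T.
have mn (A : set T) : A !=set0 -> exists2 z, A z & forall y, A y -> R z y.
  move=> [x Ax]; have [|z [[zA zl] _]] := Rwo [pred u | `[< A u >]].
    by exists x; exact/asboolP.
  by exists z => [|y Ay]; [exact/asboolP|apply: zl; exact/asboolP].
have Rt x y : R x y \/ R y x.
  have [|z [->|->] h] := mn [set x; y]; first by exists x; left.
    by left; apply: h; right.
  by right; apply: h; left.
have Rr x : R x x by case: (Rt x x).
have Ra x y : R x y -> R y x -> x = y.
  move=> xy yx; have [|z [_ zu]] := Rwo [pred u | `[< u = x \/ u = y >]].
    by exists x; apply/asboolP; left.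
  rewrite -(zu x) ?(zu y) //; split; try by apply/asboolP; auto.
    by move=> t /asboolP[]->.
  by move=> t /asboolP[]->.
have Rtr y x z : R x y -> R y z -> R x z.
  move=> xy yz.
  have [|t] := mn [set u | [\/ u = x, u = y | u = z]]; first by exists x; constructor.
  move=> tE h; have [tx ty tz] : [/\ R t x, R t y & R t z].
    by split; apply: h; constructor.
  by case: tE tx ty tz => -> tx ty tz //; [rewrite (Ra _ _ xy)|rewrite -(Ra _ _ yz)].
pose lt x y := ~~ R y x.
have lt_trans x y z : lt x y -> lt y z -> lt x z.
  move=> xy yz; apply/negP => zx.
  have [xy'|yx] := Rt x y; last by rewrite /lt yx in xy.
  by rewrite /lt (Rtr x) in yz.
have lt_total x y : lt x y \/ x = y \/ lt y x.
  rewrite /lt; case yx : (R y x); last by left.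
  case xy : (R x y); last by right; right.
  by right; left; exact: Ra.
have lt_wf : well_founded lt.
  move=> x; apply: contrapT => nx.
  have [|z nz h] := mn [set u | ~ Acc lt u]; first by exists x.
  apply: nz; constructor => y.
  rewrite /lt => /negP zy; apply: contrapT => ny; apply: zy.
  exact: h.
exists (ord_of (WellOrder lt_trans lt_total lt_wf)).
exact: card_seg (WellOrder lt_trans lt_total lt_wf).
Qed.

(** The sets on which [ocard] takes its meaningful value. *)
Definition small T (A : set T) := exists a, seg a #= A.

(** The image of A in S is turned into a sigma type, which stays in the universe
    of S even when that of T is larger. *)
Lemma small_le (S T : Type) (A : set T) : A #<= [set: S] -> small A.
Proof.
move=> /card_leP[g]; pose f (x : A) : S := val (g x).
have [a aE] := small_type {x : S | range f x}.
exists a; apply: (card_eq_trans aE); apply: (@card_eq_trans _ _ _ _ (range f)).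
  have E : sval @` [set: {x : S | range f x}] = range f.
    by apply/seteqP; split=> [_ [[x fx] _ <-]//|x fx]; exists (exist _ x fx).
  by rewrite -[X in _ #= X]E card_eq_sym; apply: inj_card_eq => -[x fx] [y fy] _ _; exact: eq_exist.
rewrite (card_eq_trans _ (card_setT A))//.
by apply: inj_card_eq => x y xA yA /val_inj; apply: inj; rewrite ?in_setT.
Qed.

Lemma small_le_seg T (A : set T) (a : Ord) : A #<= seg a -> small A.
Proof.
have [w ->] := ord_rep a => Aa; apply: (@small_le w).
by rewrite -(card_le_eqr (card_seg w)).
Qed.

(** If a is the type of w, sets of ordinals below a are encoded by predicates
    on w. *)
Lemma small_subsets (A : set (set Ord)) a :
  (forall x, A x -> x `<=` seg a) -> small A.
Proof.
have [w ->] := ord_rep a => Aw; apply: (@small_le (w -> Prop)).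
apply/pcard_injP; exists (fun x => [set y : w | x (ord_of (wseg y))]).
have sub x y : x \in A -> [set z : w | x (ord_of (wseg z))] =
    [set z : w | y (ord_of (wseg z))] -> x `<=` y.
  rewrite inE => Ax e b xb.
  have /Ord_ltP/olt_segP[z bz] : seg (ord_of w) b by exact: Aw xb.
  have : [set z : w | x (ord_of (wseg z))] z by rewrite /= -bz.
  by rewrite e /= -bz.
by move=> x y Ax Ay e; apply/seteqP; split; apply: sub.
Qed.

Lemma le_seg (a b : Ord) : a <= b -> seg a `<=` seg b.
Proof. by move=> ab c; rewrite /seg /= => /lt_le_trans; apply. Qed.

Lemma card_le_seg (a b : Ord) : a <= b -> seg a #<= seg b.
Proof. by move=> /le_seg/subset_card_le. Qed.

Lemma card_ocard T (A : set T) : small A -> seg (ocard A) #= A.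
Proof. by move=> sA; have [] := leastP sA. Qed.

Lemma ocard_leP T (A : set T) (a : Ord) : small A -> ocard A <= a <-> A #<= seg a.
Proof.
move=> sA; split=> [/card_le_seg|Aa]; first by rewrite (card_le_eql (card_ocard sA)).
rewrite leNgt; apply/negP => aA.
have : a < a; last by rewrite ltxx.
apply: (lt_le_trans aA); have [_] := leastP sA; apply => /=.
rewrite card_eq_le Aa andbT.
by rewrite -(card_le_eqr (card_ocard sA)); exact/card_le_seg/ltW.
Qed.

Lemma ocard_congr T U (A : set T) (B : set U) : A #= B -> ocard A = ocard B.
Proof.
move=> AB; rewrite /ocard; congr least; apply/seteqP.
by split=> a /=; rewrite (card_eqr AB).
Qed.

Lemma small_seg a : small (seg a). Proof. by exists a. Qed.

Lemma cardinal_ocard T (A : set T) : small A -> is_cardinal (ocard A).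
Proof. by move=> sA; exact/ocard_congr/card_ocard. Qed.

Lemma cardinal_leP (k a : Ord) : is_cardinal k -> k <= a <-> seg k #<= seg a.
Proof. by move=> kc; rewrite -{1}kc ocard_leP //; exact: small_seg. Qed.

(** The cardinal of the predicates on a well-order of type a exceeds a, by
    Cantor's diagonal argument. *)
Lemma hartogs (a : Ord) : exists2 b, is_cardinal b & a < b.
Proof.
have [w ->] := ord_rep a; have [b bE] := small_type (w -> Prop).
have sw : small [set: w -> Prop] by exists b.
exists (ocard [set: w -> Prop]); first exact: cardinal_ocard.
rewrite ltNge; apply/negP => /(ocard_leP _ sw).
rewrite (card_le_eqr (card_seg w)) => /card_leP[g].
pose f (x : w -> Prop) : w := val (g (exist _ x (mem_setT x))).
have fi : injective f.
  by move=> x y /val_inj/(@inj _ _ _ g); rewrite !in_setT => /(_ erefl erefl) [].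
pose D (y : w) := exists2 x, f x = y & ~ x y.
have nDD : ~ D (f D) by move=> /[dup] Df [x /fi ->].
by apply: (nDD); exists D.
Qed.

Lemma succ_cardP (a : Ord) : [/\ is_cardinal (succ_card a), a < succ_card a &
  forall b, is_cardinal b -> a < b -> succ_card a <= b].
Proof.
have [|[sc sa] sm] := @leastP [set b | is_cardinal b /\ a < b].
  by have [b bc ab] := hartogs a; exists b.
by split=> // b bc ab; exact: sm.
Qed.

Lemma lt_succ_cardP (a c : Ord) : c < succ_card a <-> seg c #<= seg a.
Proof.
have [sc sa sm] := succ_cardP a; split=> [ca|].
  apply/(ocard_leP _ (small_seg c)); rewrite leNgt; apply/negP => ac.
  have := sm _ (cardinal_ocard (small_seg c)) ac; rewrite leNgt => /negP; apply.
  by apply: le_lt_trans ca; apply/(ocard_leP _ (small_seg c)).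
move=> ca; rewrite ltNge; apply/negP => sc_c.
have : succ_card a <= a; last by rewrite leNgt sa.
by apply/cardinal_leP => //; apply: card_le_trans ca; exact: card_le_seg.
Qed.

Lemma ocard_lt_succ_cardP T (A : set T) (a : Ord) :
  small A -> ocard A < succ_card a <-> A #<= seg a.
Proof. by move=> sA; rewrite lt_succ_cardP (card_le_eql (card_ocard sA)). Qed.

(** Hilbert's hotel: along an injective sequence f in A, send f 0 to x and
    f (n + 1) to f n. *)
Lemma infinite_setU1_le T (A : set T) x : infinite_set A -> x |` A #<= A.
Proof.
elim/Ppointed: T => T in A x *; first by case: (T x).
move=> /infiniteP/pcard_leP[f].
have fA n : A (f n) by apply: (@funS _ _ setT A f).
have fi : injective f by move=> m n; apply: inj; rewrite in_setT.
pose h y := if pselect (exists n, f n = y) is left e then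
  (if projT1 (cid e) is n.+1 then f n else x) else y.
have hf n : h (f n) = if n is m.+1 then f m else x.
  rewrite /h; case: pselect => [e|[]]; last by exists n.
  by case: cid => m /= /fi ->.
apply/pcard_surjP; exists h => y [->|Ay]; first by exists (f 0); rewrite ?hf.
have [[n nE]|ny] := pselect (exists n, f n = y).
  by exists (f n.+1); rewrite ?hf.
by exists y => //; rewrite /h; case: pselect.
Qed.

Lemma infinite_cardinal_lim (k a : Ord) :
  infinite_cardinal k -> a < k -> exists2 b, a < b & b < k.
Proof.
move=> [kc ki] ak; apply: contrapT => nb.
have sub : seg k `<=` a |` seg a.
  move=> c ck; have [ca|ac|->] := ltgtP c a; [by right| |by left].
  by case: nb; exists c.
have ai : infinite_set (seg a).
  move=> af; apply: ki; apply: (sub_finite_set sub).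
  by rewrite finite_setU; split=> //; exact: finite_set1.
have : k <= a; last by rewrite leNgt ak.
apply/cardinal_leP => //.
exact: card_le_trans (subset_card_le sub) (infinite_setU1_le _ ai).
Qed.

(** * Products of cardinals and regularity of successors *)

Definition lex_rel (A B : Type) (RA : A -> A -> Prop) (RB : B -> B -> Prop)
    (p q : A * B) : Prop :=
  RA p.1 q.1 \/ p.1 = q.1 /\ RB p.2 q.2.

Section Lex.
Variables v w : wellorder.
Let R := lex_rel (@wlt v) (@wlt w).

Lemma lex_trans x y z : R x y -> R y z -> R x z.
Proof.
case: x y z => [x1 x2] [y1 y2] [z1 z2]; rewrite /R /lex_rel /=.
case=> [xy|[-> xy]] [yz|[<- yz]]; [left|by left|by left|right].
  exact: wlt_trans yz.
by split=> //; exact: wlt_trans yz.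
Qed.

Lemma lex_total x y : R x y \/ x = y \/ R y x.
Proof.
case: x y => [x1 x2] [y1 y2]; rewrite /R /lex_rel /=.
case: (wlt_total x1 y1) => [|[->|]]; [by left; left| |by right; right; left].
by case: (wlt_total x2 y2) => [|[->|]]; [left; right|right; left|right; right; right].
Qed.

Lemma lex_wf : well_founded R.
Proof.
move=> [x y]; elim: {x}(wlt_wf x) y => x _ IHx y.
elim: {y}(wlt_wf y) => y _ IHy; constructor=> -[x' y'] [/= /IHx//|[/= ->]].
exact: IHy.
Qed.

Definition lex_wellorder : wellorder := WellOrder lex_trans lex_total lex_wf.
End Lex.

Section Pull.
Variables (S : Type) (w : wellorder) (f : S -> w).
Hypothesis fi : injective f.
Let R (x y : S) := wlt (f x) (f y).

Lemma pull_total x y : R x y \/ x = y \/ R y x.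
Proof.
by case: (wlt_total (f x) (f y)) => [|[/fi|]]; [left|right; left|right; right].
Qed.

Lemma pull_wf : well_founded R.
Proof.
move=> x; move e : (f x) => y; elim: {y}(wlt_wf y) x e => y _ IH x e.
by constructor=> z; rewrite /R e => /IH; apply.
Qed.

Definition pull_wellorder : wellorder :=
  WellOrder (fun x y z => @wlt_trans w (f x) (f y) (f z)) pull_total pull_wf.
End Pull.

Lemma card_setX_le T T' U U' (A : set T) (A' : set T') (B : set U) (B' : set U') :
  A #<= B -> A' #<= B' -> A `*` A' #<= B `*` B'.
Proof.
elim/Ppointed: T => T in A *.
  by rewrite (empty_eq0 A) set0X => _ _; exact: card_ge0.
elim/Ppointed: T' => T' in A' *.
  by rewrite (empty_eq0 A') setX0 => _ _; exact: card_ge0.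
move=> /pcard_surjP[f fs] /pcard_surjP[g gs]; apply/pcard_surjP.
exists (fun p => (f p.1, g p.2)) => -[x y] [/= /fs[a Aa <-] /gs[b Bb <-]].
by exists (a, b).
Qed.

(** Hessenberg's theorem; an infinite ordinal reduces to its cardinal, so let a
    be one. Order pairs by their maximum, then lexicographically.
    A pair with maximum below m has its predecessors in m * m, so by induction
    every proper initial segment of this order on a * a is smaller than the
    infinite cardinal a. Hence the order type of a * a is at most a. *)
Lemma card_setX_self_le (a : Ord) : infinite_set (seg a) -> seg a `*` seg a #<= seg a.
Proof.
elim: {a}(Ord_wf a) => a _ IH ai.
have [ac|anc] := pselect (is_cardinal a); last first.
  have E := card_ocard (small_seg a).
  have oa : ocard (seg a) < a.
    rewrite lt_neqAle; apply/andP; split; first exact/eqP.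
    by apply/ocard_leP => //; exact: small_seg.
  have [aE Ea] : seg a #<= seg (ocard (seg a)) /\ seg (ocard (seg a)) #<= seg a.
    by apply/andP; rewrite andbC -card_eq_le.
  have oi : infinite_set (seg (ocard (seg a))) by move=> /(card_le_finite aE).
  apply: card_le_trans (card_setX_le aE aE) _.
  exact: card_le_trans (IH _ oa oi) Ea.
have [w aw] := ord_rep a.
pose mx (p : w * w) := if pselect (wlt p.1 p.2) then p.2 else p.1.
have gi : injective (fun p : w * w => (mx p, p)) by move=> p q [_].
(* The Godel order: the first coordinate mx p of the key decides first. *)
pose W := @pull_wellorder _ (lex_wellorder w (lex_wellorder w w)) _ gi.
have wa : seg a #= [set: w] by rewrite aw; exact: card_seg.
suff Wa : [set: W] #<= seg a.
  apply: card_le_trans Wa; rewrite -setXTT; apply: card_setX_le.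
    by rewrite (card_le_eql wa).
  by rewrite (card_le_eql wa).
rewrite -(card_le_eql (card_seg W)).
have [/card_le_seg //|] := leP (ord_of W) a.
move=> /Ord_ltP/olt_segP[y ay].
have [|m my ma] := @infinite_cardinal_lim a (ord_of (wseg (mx y))) (conj ac ai).
  by rewrite [ltRHS]aw; apply/Ord_ltP/olt_segP; exists (mx y).
pose o (x : w) := ord_of (wseg x).
have oi : injective o.
  move=> p q e; case: (wlt_total p q) => [|[//|]] /wlt_segP;
  by rewrite -/(o p) -/(o q) e => /olt_irr.
have om (p : w * w) : wlt (mx p, p).1 (mx y, y).1 \/ mx p = mx y -> o p.1 < m /\ o p.2 < m.
  have lt_o x z : ~ wlt z x -> o x <= o z.
    by move=> zx; rewrite leNgt; apply/negP => /Ord_ltP/wlt_segP.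
  move=> pm.
  have : o (mx p) <= o (mx y).
    by case: pm => [/wlt_segP/Ord_ltP/ltW|->] //.
  move=> /le_lt_trans/(_ my) pm'.
  suff [h1 h2] : o p.1 <= o (mx p) /\ o p.2 <= o (mx p).
    by split; apply: le_lt_trans pm'.
  rewrite /mx; case: pselect => [p12|/lt_o //]; split=> //.
  by apply/ltW/Ord_ltP/wlt_segP.
have am : seg a #<= seg m `*` seg m.
  rewrite ay (card_le_eql (card_seg _)).
  rewrite -(card_le_eql (inj_card_eq (f := fun p : wseg y => (o (sval p).1, o (sval p).2)) _)).
    apply: subset_card_le => _ [[p py] _ <-] /=; apply: om.
    by case: py => [|[]] /=; [left|right].
  move=> [[p1 p2] p] [[q1 q2] q] _ _ e.
  have /= /oi e1 := congr1 fst e; have /= /oi e2 := congr1 snd e.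
  by apply: eq_exist; rewrite /= e1 e2.
have [mf|mi] := pselect (finite_set (seg m)).
  by case: ai; apply: card_le_finite am _; exact: finite_setX.
have : a <= m; last by rewrite leNgt ma.
by apply/cardinal_leP => //; exact: card_le_trans am (IH _ ma mi).
Qed.

Lemma card_bigcup_le T (a : Ord) (I : Type) (x : set I) (F : I -> set T) :
  infinite_set (seg a) -> x #<= seg a -> (forall i, x i -> F i #<= seg a) ->
  \bigcup_(i in x) F i #<= seg a.
Proof.
move=> ai xa Fa; apply: card_le_trans (card_setX_self_le ai).
elim/Ppointed: T => T in F Fa *.
  by rewrite (empty_eq0 (\bigcup_(_ in _) _)) card_ge0.
have [i0|] := pselect (inhabited I).
  elim/Ppointed: I => I in F x i0 xa Fa *; first by case: i0 => i; case: (no i).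
  have /pcard_surjP[f fs] := xa.
  have g i : exists g : Ord -> T, x i -> set_surj (seg a) (F i) g.
    have [xi|nxi] := pselect (x i); last by exists (fun=> point).
    by have /pcard_surjP[g gs] := Fa _ xi; exists g.
  have [g' g'P] := choice g.
  apply/pcard_surjP; exists (fun p => g' (f p.1) p.2) => t [i xi Fit].
  have [b ba bi] := fs _ xi; subst i; have [c ca <-] := g'P _ xi _ Fit.
  by exists (b, c).
move=> nI; rewrite (_ : \bigcup_(_ in _) _ = set0) ?card_ge0// -subset0.
by move=> t [i]; case: nI.
Qed.

Lemma infinite_succ_card (a : Ord) : infinite_cardinal a -> infinite_cardinal (succ_card a).
Proof.
have [sc asc _] := succ_cardP a.
by move=> [_ ai]; split=> //; apply: sub_infinite_set ai; exact/le_seg/ltW.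
Qed.

(** If x were unbounded, the successor of a would be the union of at most a initial segments,
    each of size at most a. *)
Lemma succ_card_regular (a : Ord) (x : set Ord) : infinite_cardinal a ->
  x `<=` seg (succ_card a) -> x #<= seg a ->
  exists2 b, b < succ_card a & forall c, x c -> c < b.
Proof.
move=> ai xs xa; have [sc asc _] := succ_cardP a.
suff [b bs bx] : exists2 b, b < succ_card a & forall c, x c -> c <= b.
  have [d bd ds] := infinite_cardinal_lim (infinite_succ_card ai) bs.
  by exists d => // c /bx /le_lt_trans; apply.
apply: contrapT => nb; have : succ_card a <= a; last by rewrite leNgt asc.
apply/cardinal_leP => //; have := @card_bigcup_le _ a _ x seg ai.2 xa.
move=> /(_ (fun c xc => (lt_succ_cardP a c).1 (xs _ xc))); apply: card_le_trans.
apply: subset_card_le => b bs; apply: contrapT => nbx; apply: nb.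
by exists b => // c xc; rewrite leNgt; apply/negP => bc; apply: nbx; exists c.
Qed.

(** * Suprema, cofinality and clubs *)

Lemma zero_ord_le (a : Ord) : zero_ord <= a.
Proof.
rewrite leNgt; apply/negP => /Ord_ltP/olt_segP[[]].
Qed.

Lemma osupP (x : set Ord) (u : Ord) : x !=set0 -> ubound x u ->
  ubound x (osup x) /\ forall v, ubound x v -> osup x <= v.
Proof.
move=> x0 xu; have [lu lm] := @leastP (ubound x) (ex_intro _ u xu).
rewrite /osup /supremum ifF; last by apply/negbTE/set0P.
have [ub lb] := @xgetPex _ zero_ord (supremums x) (ex_intro _ _ (conj lu lm)).
by split.
Qed.

Lemma lt_osup (x : set Ord) (u a : Ord) : x !=set0 -> ubound x u -> a < osup x ->
  exists2 c, x c & a < c.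
Proof.
move=> x0 xu ax; apply: contrapT => nc.
have : osup x <= a; last by rewrite leNgt ax.
apply: (osupP x0 xu).2 => c xc; rewrite leNgt; apply/negP => ac.
by apply: nc; exists c.
Qed.

Lemma osup_unbounded (x : set Ord) (d : Ord) : zero_ord < d -> x `<=` seg d ->
  (forall a, a < d -> exists2 c, x c & a < c) -> osup x = d.
Proof.
move=> d0 xd xc; have x0 : x !=set0 by have [c] := xc _ d0; exists c.
have [|ub lb] := @osupP x d x0; first by move=> c /xd/ltW.
apply/eqP; rewrite eq_le lb /=; last by move=> c /xd/ltW.
rewrite leNgt; apply/negP => /[dup] sd /xc[c /ub cs].
by rewrite ltNge cs.
Qed.

Lemma osup_cofinal (x : set Ord) (d : Ord) : infinite_limit d -> cofinal_in d x ->
  osup x = d.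
Proof.
move=> [d0 dl] [xd xc]; apply: osup_unbounded => // a /dl[b ab /xc[c xc' bc]].
by exists c => //; exact: lt_le_trans bc.
Qed.

Lemma unbounded_osup (x : set Ord) (d : Ord) : zero_ord < d -> x `<=` seg d ->
  osup x = d -> forall a, a < d -> exists2 c, x c & a < c.
Proof.
move=> d0 xd xs a ad; have [x0|/set0P x0] := eqVneq x set0.
  by move: d0; rewrite -xs x0 /osup supremum0 ltxx.
by apply: (@lt_osup _ d) => //; [move=> c /xd/ltW|rewrite xs].
Qed.

(** The bound [b] is uniform in [c <= a], so that at a member [d] the values of
    [f] on each proper initial segment of [d] are bounded below [d]; [a < b]
    makes every member a limit. *)
Definition closure_points (tau : Ord) (f : Ord -> Ord) : set Ord :=
  [set d | [/\ d < tau, zero_ord < d &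
    forall a, a < d -> exists2 b, a < b < d & forall c, c <= a -> f c < b]].

Lemma closure_points_limit tau f d : closure_points tau f d -> infinite_limit d.
Proof. by move=> [_ d0 h]; split=> // a /h[b /andP[ab bd] _]; exists b. Qed.

(** By regularity some F strictly bounds f on initial segments; a member above b
    is the supremum of the iterates of F at b, which are countably many and so
    bounded. *)
Lemma club_closure_points (lam : Ord) (f : Ord -> Ord) : infinite_cardinal lam ->
  (forall a, a < succ_card lam -> f a < succ_card lam) ->
  club (succ_card lam) (closure_points (succ_card lam) f).
Proof.
move=> li fs; set tau := succ_card lam in fs *.
split; last first.
  move=> x xC x0 st; have xu : ubound x tau by move=> c /xC[/ltW].
  have [ub lb] := osupP x0 xu; split=> //.
    by case: x0 => c /[dup] /xC[_ c0 _] /ub; exact: lt_le_trans.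
  move=> a /(lt_osup x0 xu)[c xc ac]; have [_ _ /(_ _ ac)[b /andP[ab bc] h]] := xC _ xc.
  by exists b => //; rewrite ab (lt_le_trans bc)// ub.
split=> [c []//|b bt].
have tl := infinite_cardinal_lim (infinite_succ_card li).
have [F FP] : exists F : Ord -> Ord, forall a, a < tau ->
    [/\ F a < tau, a < F a & forall c, c <= a -> f c < F a].
  suff /choice[F FP] : forall a, exists b, a < tau ->
    [/\ b < tau, a < b & forall c, c <= a -> f c < b] by exists F.
  move=> a; have [at'|na] := pselect (a < tau); last by exists a.
  have [a' aa' a't] := tl _ at'.
  have [||d dt dP] := @succ_card_regular lam (f @` seg a') li.
  - by move=> _ [c /lt_trans/(_ a't)/fs ? <-].
  - by apply: card_le_trans (card_image_le _ _) _; apply/lt_succ_cardP.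
  exists (Order.max a' d) => _; split; first by rewrite gt_max a't.
    by rewrite lt_max aa'.
  move=> c ca; rewrite lt_max dP ?orbT//; exists c => //; exact: le_lt_trans aa'.
pose s n := iter n F (F b).
have st n : s n < tau.
  by elim: n => [|n IH] /=; [have [] := FP _ bt|have [] := FP _ IH].
have sS n : s n < s n.+1 by have [] := FP _ (st n).
have [||e et eP] := @succ_card_regular lam (range s) li.
- by move=> _ [n _ <-]; exact: st.
- by apply: card_le_trans (card_image_le _ _) _; apply/infiniteP; exact: li.2.
have xu : ubound (range s) e by move=> c /eP/ltW.
have x0 : range s !=set0 by exists (s 0); exists 0.
have [ub lb] := osupP x0 xu.
have bs : b < osup (range s).
  have [_ bF _] := FP _ bt; apply: lt_le_trans bF _.
  by apply: ub; exists 0.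
exists (osup (range s)); last exact: ltW.
split; first by apply: le_lt_trans et; exact: lb.
  exact: le_lt_trans (zero_ord_le _) bs.
move=> a /(lt_osup x0 xu)[_ [n _ <-] an].
have [_ _ h] := FP _ (st n); exists (s n.+1).
  rewrite (lt_trans an (sS n)) /= (lt_le_trans (sS n.+1))//.
  by apply: ub; exists n.+2.
by move=> c ca; apply: h; apply/ltW/(le_lt_trans ca).
Qed.

Lemma club_limit_mem (tau : Ord) (C : set Ord) (d : Ord) : club tau C ->
  d < tau -> zero_ord < d -> (forall a, a < d -> exists2 c, C c & a < c < d) -> C d.
Proof.
move=> [_ Cc] dt d0 h.
have E : osup (C `&` seg d) = d.
  apply: osup_unbounded => //.
  by move=> a /h[c Cc' /andP[ac cd]]; exists c.
rewrite -E; apply: Cc; first by move=> c [].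
  by have [c Cc' /andP[_ cd]] := h _ d0; exists c.
by rewrite E.
Qed.

Definition next_in (A : set Ord) (a : Ord) : Ord := least (A `&` [set c | a < c]).

Lemma next_inP (tau : Ord) (A : set Ord) (a : Ord) : infinite_cardinal tau ->
  cofinal_in tau A -> a < tau -> [/\ A (next_in A a), a < next_in A a & next_in A a < tau].
Proof.
move=> ti [At Ac] aT; have [b ab bt] := infinite_cardinal_lim ti aT.
have [c Acc bc] := Ac _ bt.
have [|[h1 h2] _] := @leastP (A `&` [set c | a < c]).
  by exists c; split=> //; exact: lt_le_trans bc.
by split=> //; exact: At h1.
Qed.

(** Suitable f turn the points of closure into limits of A; when A is a club they
    are then members of it, by [club_limit_mem], so this also serves to
    intersect clubs. *)
Lemma closure_points_next tau (A : set Ord) f d : infinite_cardinal tau ->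
  cofinal_in tau A ->
  closure_points tau f d -> (forall a, a < tau -> next_in A a <= f a) ->
  forall a, a < d -> exists2 c, A c & a < c < d.
Proof.
move=> ti Ac [dt d0 h] nf a ad; have aT := lt_trans ad dt.
have [An an nt] := next_inP ti Ac aT; exists (next_in A a) => //.
have [b /andP[_ bd] fb] := h _ ad.
by rewrite an (le_lt_trans (nf _ aT))// (lt_trans _ bd)// fb.
Qed.

Lemma dual_filter_NS (tau : Ord) (E X : set Ord) : X `<=` seg tau ->
  dual_filter tau (ideal_restr tau (NS tau) E) X <->
  exists2 C, club tau C & C `&` E `<=` X.
Proof.
move=> Xt; split=> [[_ [_ [_ [C Cc CX]]]]|[C Cc CX]].
  exists C => // d [Cd Ed]; apply: contrapT => nX.
  have : ((seg tau `\` X) `&` E `&` C) d.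
    by split=> //; split=> //; split=> //; have [[Ct _] _] := Cc; exact: Ct.
  by rewrite CX.
split=> //; split; first by move=> d [].
split; first by move=> d [[]].
exists C => //; rewrite -subset0 => d [[[_ nX] Ed] Cd].
by apply: nX; exact: CX.
Qed.

Lemma cofinal_seg (d : Ord) : cofinal_in d (seg d).
Proof. by split=> // b bd; exists b. Qed.

Lemma cfP (d : Ord) : (exists2 x, cofinal_in d x & ocard x = cf d) /\
  forall x, cofinal_in d x -> cf d <= ocard x.
Proof.
have [|cx cm] := @leastP [set k | exists2 x, cofinal_in d x & ocard x = k].
  by exists (ocard (seg d)); exists (seg d) => //; exact: cofinal_seg.
by split=> // x xc; apply: cm; exists x.
Qed.

Lemma not_cofinal_bounded (d : Ord) (y : set Ord) : y `<=` seg d -> ~ cofinal_in d y ->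
  exists2 b, b < d & forall c, y c -> c < b.
Proof.
move=> yd nc; apply: contrapT => nb; apply: nc; split=> // b bd.
apply: contrapT => nby; apply: nb; exists b => // c yc.
by rewrite ltNge; apply/negP => bc; apply: nby; exists c.
Qed.

(** Fewer than cf d bounded pieces have bounds that are themselves bounded, so a
    cofinal set covered by fewer than cf d pieces has a cofinal piece. *)
Lemma cofinal_bigcup (d : Ord) (I : Type) (Q : set I) (F : I -> set Ord) (x : set Ord) :
  small Q -> ocard Q < cf d -> cofinal_in d x -> x `<=` \bigcup_(q in Q) F q ->
  exists2 q, Q q & cofinal_in d (x `&` F q).
Proof.
move=> Qs Qd [xd xc] xF; apply: contrapT => nq.
have /choice[b bP] : forall q, exists b, Q q -> b < d /\ forall c, (x `&` F q) c -> c < b.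
  move=> q; have [Qq|nQ] := pselect (Q q); last by exists d.
  have [||b bd bF] := @not_cofinal_bounded d (x `&` F q).
  - by move=> c [/xd].
  - by move=> cF; apply: nq; exists q.
  by exists b.
have [||e ed eP] := @not_cofinal_bounded d (b @` Q).
- by move=> _ [q /bP[? _] <-].
- move=> /((cfP d).2); apply/negP; rewrite -ltNge; apply: le_lt_trans Qd.
  have bQ : b @` Q #<= seg (ocard Q).
    by rewrite (card_le_eqr (card_ocard Qs)); exact: card_image_le.
  by apply/ocard_leP => //; exact: small_le_seg bQ.
have [c xc' ec] := xc _ ed; have [q Qq Fq] := xF _ xc'.
have [_ /(_ c (conj xc' Fq)) cb] := bP _ Qq.
have : b q < e by apply: eP; exists q.
by move=> be; have := lt_trans (le_lt_trans ec cb) be; rewrite ltxx.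
Qed.

Lemma small_ords (d : Ord) (x : set Ord) : x `<=` seg d -> small x.
Proof. by move=> xd; exact/small_le_seg/subset_card_le/xd. Qed.

Lemma cofinal_thin (d : Ord) (A : set Ord) : cofinal_in d A ->
  exists y, [/\ y `<=` A, cofinal_in d y & y #<= seg (cf d)].
Proof.
move=> [Ad Ac]; have [[x [xd xc] xE] _] := cfP d.
have /choice[h hP] : forall c, exists a, c < d -> A a /\ c <= a.
  move=> c; have [/Ac[a]|] := pselect (c < d); last by exists c.
  by exists a.
have yA : h @` x `<=` A by move=> _ [c /xd/hP[? _] <-].
exists (h @` x); split=> //; last first.
  apply: card_le_trans (card_image_le _ _) _.
  by rewrite -xE (card_le_eqr (card_ocard (small_ords xd))).
split=> [c /yA/Ad//|b /xc[c xc' bc]].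
have [_ ch] := hP _ (xd _ xc').
by exists (h c); [exists c|exact: le_trans ch].
Qed.

(** * Covering and dense families *)

Lemma ocard_set1_lt2 T (x : T) : ocard [set x] < ocard `I_2.
Proof.
have nat_small (n : nat) : small `I_n by apply: (@small_le nat); exact: card_leT.
rewrite (ocard_congr (card_set1 (x := x))) ltNge; apply/negP => /ocard_leP-/(_ (nat_small 2)).
by rewrite (card_le_eqr (card_ocard (nat_small 1))) card_le_II.
Qed.

Definition covering (mu lam : Ord) (X : set (set Ord)) : Prop :=
  (forall x, X x -> x `<=` seg lam /\ x #<= seg mu) /\
  forall b, b `<=` seg lam -> b #<= seg mu ->
    exists Q, [/\ Q `<=` X, ocard Q < mu & b `<=` \bigcup_(q in Q) q].

Definition dense (mu : Ord) (D : set (set Ord)) : Prop :=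
  (forall q, D q -> q `<=` seg mu /\ ocard q = mu) /\
  forall b, b `<=` seg mu -> ocard b = mu -> exists2 q, D q & q `<=` b.

(** The least value in the definition of [cov] is attained because the family
    of all subsets of lam of size at most mu covers by singletons, 1 < sigma. *)
Lemma covering_family (mu lam : Ord) : revision_cardinal lam (succ_card mu) ->
  exists2 X : set (set Ord), X #<= seg lam & covering mu lam X.
Proof.
move=> [_ _ _ [sigma [sc s2 smu covle]]].
have [sc_mu mu_sc mu_min] := succ_cardP mu.
have sigma_mu : sigma <= mu.
  by rewrite leNgt; apply/negP => /(mu_min _ sc); rewrite leNgt smu.
have small_lam (x : set Ord) : x `<=` seg lam -> small x by exact: small_ords.
have [|[X [Xs XQ Xc]] _] := @leastP [set k | exists X : set (set Ord),
    [/\ X `<=` subsets_lt (succ_card mu) (seg lam),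
        forall b, subsets_lt (succ_card mu) (seg lam) b ->
          exists2 Q, subsets_lt sigma X Q & b `<=` \bigcup_(q in Q) q
      & ocard X = k]].
  exists (ocard (subsets_lt (succ_card mu) (seg lam))).
  exists (subsets_lt (succ_card mu) (seg lam)); split=> // b bs.
  exists [set b]; last by move=> c bc; exists b.
  by split=> [_ -> //|]; exact: lt_le_trans (ocard_set1_lt2 b) s2.
exists X.
  by apply/ocard_leP; [apply: (@small_subsets _ lam) => x /Xs[]|rewrite Xc].
split.
- by move=> x /Xs[xl]; rewrite ocard_lt_succ_cardP//; exact: small_lam.
- move=> b bl bm; have [|Q [QX Qs] bQ] := XQ b.
    by split=> //; apply/ocard_lt_succ_cardP => //; exact: small_lam.
  by exists Q; split=> //; exact: lt_le_trans sigma_mu.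
Qed.

Lemma dense_family (mu : Ord) : exists2 D : set (set Ord),
  D #<= seg (density mu mu) & dense mu D.
Proof.
have [|[D [Ds Db Dc]] _] := @leastP [set k | exists Q : set (set Ord),
    [/\ Q `<=` subsets_eq mu (seg mu),
        forall b, subsets_eq mu (seg mu) b -> exists2 q, Q q & q `<=` b
      & ocard Q = k]].
  exists (ocard (subsets_eq mu (seg mu))), (subsets_eq mu (seg mu)).
  by split=> // b bs; exists b.
exists D.
  by apply/ocard_leP; [apply: (@small_subsets _ mu) => x /Ds[]|rewrite Dc].
split.
- by move=> q /Ds[].
- by move=> b bm bc; apply: Db.
Qed.

Lemma surjections_below_succ (lam : Ord) : exists g : Ord -> Ord -> Ord,
  forall d, d < succ_card lam -> seg d `<=` g d @` seg lam.
Proof.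
suff /choice[g gP] : forall d, exists g : Ord -> Ord, d < succ_card lam ->
  seg d `<=` g @` seg lam by exists g.
move=> d; have [/lt_succ_cardP/pcard_surjP[g gP]|nd] := pselect (d < succ_card lam).
  by exists g.
by exists id.
Qed.

Lemma cofinal_sub (d : Ord) (x y : set Ord) : x `<=` y -> y `<=` seg d ->
  cofinal_in d x -> cofinal_in d y.
Proof.
move=> xy yd [xd xc]; split=> // b /xc[c xc' bc].
by exists c => //; exact: xy.
Qed.

(** A cofinal subset of A of size cf d = mu pulls back along g to a set of size
    at most mu, which is covered by fewer than mu = cf d members of X. *)
Lemma covering_guess (mu lam d : Ord) (X : set (set Ord)) (g : Ord -> Ord) (A : set Ord) :
  covering mu lam X -> seg d `<=` g @` seg lam -> cf d = mu -> cofinal_in d A ->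
  exists2 x, X x & cofinal_in d (A `&` g @` x).
Proof.
move=> [Xs XQ] gd cd Ac; have [y [yA yc ym]] := cofinal_thin Ac.
have /choice[h hP] : forall c, exists i, c < d -> i < lam /\ g i = c.
  move=> c; have [/gd[i]|] := pselect (c < d); last by exists c.
  by exists i.
have [||Q [QX Qm hQ]] := XQ (h @` y).
- by move=> _ [c /(yc.1)/hP[? _] <-].
- by rewrite -cd; apply: card_le_trans ym; exact: card_image_le.
have [||| q Qq qc] := @cofinal_bigcup d _ Q (fun q => g @` q) y _ _ yc.
- by apply: (@small_subsets _ lam) => x /QX/Xs[].
- by rewrite cd.
- move=> c yc'; have [|q Qq qh] := hQ (h c); first by exists c.
  by exists q => //; exists (h c) => //; have [] := hP _ (yc.1 _ yc').
exists q; first exact: QX.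
apply: cofinal_sub qc; first by move=> c [/yA].
by move=> c [/(Ac.1)].
Qed.

(** Here R is the set of indices where the enumeration u of A reaches a new
    maximum. It has size mu since its image is cofinal in d, and u is
    increasing on it, so any subset of R unbounded in mu has a cofinal
    image. *)
Lemma density_guess (mu d : Ord) (D : set (set Ord)) (u : Ord -> Ord) (A : set Ord) :
  is_cardinal mu ->
  dense mu D -> cf d = mu -> cofinal_in d (A `&` u @` seg mu) ->
  exists2 q, D q & u @` q `<=` A /\ cofinal_in d (u @` q).
Proof.
move=> muc [Ds Db] cd [Ad Ac].
pose R : set Ord := [set i | [/\ i < mu, A (u i) &
  forall j, j < i -> A (u j) -> u j < u i]].
have Rmu : R `<=` seg mu by move=> i [].
have uRd : u @` R `<=` seg d.
  by move=> _ [i [im iA _] <-]; apply: Ad; split=> //; exists i.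
have Rc : cofinal_in d (u @` R).
  split=> // b bd; have [|[im iA ib] il] := @leastP [set i | [/\ i < mu, A (u i) & b <= u i]].
    by have [c [cA [i im ic]] bc] := Ac _ bd; exists i; rewrite /= ic.
  exists (u (least [set i | [/\ i < mu, A (u i) & b <= u i]])) => //.
  eexists; last by [].
  split=> // j ji jA; apply: lt_le_trans ib; rewrite ltNge; apply/negP => bj.
  have : least [set i | [/\ i < mu, A (u i) & b <= u i]] <= j.
    by apply: il; split=> //; exact: lt_trans im.
  by rewrite leNgt ji.
have Rcard : ocard R = mu.
  have Rs : small R by exact: small_ords Rmu.
  apply/eqP; rewrite eq_le; apply/andP; split.
    by apply/ocard_leP => //; exact: subset_card_le.
  rewrite -{1}cd; apply: (le_trans ((cfP d).2 _ Rc)).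
  apply/ocard_leP; first exact: small_ords uRd.
  by rewrite (card_le_eqr (card_ocard Rs)); exact: card_image_le.
have [q Dq qR] := Db _ Rmu Rcard; exists q => //; have [qmu qcard] := Ds _ Dq.
split; first by move=> _ [i /qR[_ ? _] <-].
split; first by move=> _ [i /qR Ri <-]; apply: uRd; exists i.
move=> b bd; have [_ [i Ri <-] bi] := Rc.2 _ bd.
have [j qj ij] : exists2 j, q j & i <= j.
  apply: contrapT => nj; have [im _ _] := Ri.
  have : mu <= i; last by rewrite leNgt im.
  rewrite -qcard; apply/ocard_leP; first exact: small_ords qmu.
  apply: subset_card_le => j qj; rewrite /seg /= ltNge; apply/negP => ij.
  by apply: nj; exists j.
exists (u j); first by exists j.
apply: le_trans bi _; move: ij; rewrite le_eqVlt => /orP[/eqP->//|ij].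
by have [_ _ /(_ _ ij)] := qR _ qj; have [_ iA _] := Ri => /(_ iA)/ltW.
Qed.

Lemma unbounded_of_full (lam : Ord) (A : set Ord) :
  subsets_eq (succ_card lam) (seg (succ_card lam)) A -> cofinal_in (succ_card lam) A.
Proof.
move=> [As Ac]; apply: contrapT => /(not_cofinal_bounded As)[b bs bA].
have [_ ls _] := succ_cardP lam; have : succ_card lam <= lam; last by rewrite leNgt ls.
rewrite -{1}Ac; apply/ocard_leP; first exact: small_ords As.
by apply: card_le_trans (subset_card_le bA) _; apply/lt_succ_cardP.
Qed.

Lemma club_limit_points (lam : Ord) (A : set Ord) : infinite_cardinal lam ->
  cofinal_in (succ_card lam) A ->
  exists2 C, club (succ_card lam) C & forall d, C d ->
    [/\ d < succ_card lam, lam < d, infinite_limit d & cofinal_in d (A `&` seg d)].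
Proof.
move=> li Ac; have [_ ls _] := succ_cardP lam; have ti := infinite_succ_card li.
(* The term lam keeps the members above lam, where lam indices i < d exist. *)
pose f a := Order.max lam (next_in A a).
exists (closure_points (succ_card lam) f).
  apply: club_closure_points => // a at'; rewrite gt_max ls /=.
  by have [] := next_inP ti Ac at'.
move=> d Cd; have [dt d0 h] := Cd; split=> //.
- have [b /andP[_ bd] /(_ _ (lexx _))] := h _ d0.
  by rewrite gt_max => /andP[lb _]; exact: lt_trans bd.
- exact: closure_points_limit Cd.
- split=> [c []//|a ad].
  have [|c Acc /andP[ac cd]] := closure_points_next ti Ac Cd _ ad.
    by move=> b _; rewrite le_max lexx orbT.
  by exists c => //; exact: ltW.
Qed.

(** * The guessing principles *)

Lemma clubsuit_cof_of_covering (mu lam : Ord) (X : set (set Ord)) :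
  infinite_cardinal lam ->
  X #<= seg lam -> covering mu lam X ->
  clubsuit_cof (succ_card lam) (succ_card mu)
    (ideal_restr (succ_card lam) (NS (succ_card lam)) (Ecf (succ_card lam) mu)).
Proof.
move=> li /pcard_surjP[phi phiX] Xcov; have [g gP] := surjections_below_succ lam.
exists (fun d i => seg d `&` g d @` [set c | X (phi i) /\ phi i c]); split.
  move=> i d _ dt; split; first by move=> c [].
  apply/ocard_lt_succ_cardP; first by apply: (@small_ords d) => c [].
  apply: card_le_trans (subset_card_le (@subIsetr _ _ _)) _.
  apply: card_le_trans (card_image_le _ _) _.
  have [Xi|nXi] := pselect (X (phi i)).
    by apply: card_le_trans (Xcov.1 _ Xi).2; apply: subset_card_le => c [].
  by rewrite (_ : [set _ | _] = set0) ?card_ge0// -subset0 => c [].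
move=> A Afull; apply/dual_filter_NS; first by move=> d [].
have [C Cc CP] := club_limit_points li (unbounded_of_full Afull).
exists C => // d [/CP[dt ld dl Ad] [_ cd]]; split=> //.
have [x Xx xc] := covering_guess Xcov (gP _ dt) cd Ad.
have [i il ix] := phiX _ Xx; exists i; first exact: lt_trans ld.
have -> : [set c | X (phi i) /\ phi i c] = x.
  by rewrite ix; apply/seteqP; split=> c // [].
by rewrite setIA; exact: osup_cofinal.
Qed.

Lemma clubsuit_star_of_covering (mu lam : Ord) (X D : set (set Ord)) :
  infinite_cardinal lam -> is_cardinal mu ->
  X #<= seg lam -> covering mu lam X ->
  D #<= seg lam -> dense mu D ->
  clubsuit_star (succ_card lam)
    (ideal_restr (succ_card lam) (NS (succ_card lam)) (Ecf (succ_card lam) mu)).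
Proof.
move=> li muc XL Xcov DL Dd; have [g gP] := surjections_below_succ lam.
have /pcard_surjP[th thP] : X `*` D #<= seg lam.
  exact: card_le_trans (card_setX_le XL DL) (card_setX_self_le li.2).
have /choice[e eP] : forall x, exists e : Ord -> Ord, X x -> x `<=` e @` seg mu.
  move=> x; have [/(Xcov.1)[_ /pcard_surjP[e ex]]|] := pselect (X x); last by exists id.
  by exists e.
(* The fallback seg d in the witness is a dummy set with supremum d. *)
pose s0 d i := g d @` (e (th i).1 @` (th i).2).
exists (fun d i => if pselect (s0 d i `<=` seg d /\ osup (s0 d i) = d) then s0 d i
  else seg d); split.
  move=> i d _ dt dl; case: (pselect (s0 d i `<=` seg d /\ _)) => [h|_] /=; first by [].
  split=> //.
  exact: osup_cofinal dl (cofinal_seg d).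
move=> A Afull; apply/dual_filter_NS; first by move=> d [].
have [C Cc CP] := club_limit_points li (unbounded_of_full Afull).
exists C => // d [/CP[dt ld dl Ad] [_ cd]]; split=> //.
have [x Xx xc] := covering_guess Xcov (gP _ dt) cd Ad.
have [|q Dq [qA qc]] := density_guess (u := g d \o e x) (A := A `&` seg d) muc Dd cd.
  apply: cofinal_sub xc; last by move=> c [[]].
  move=> c [Ac [j xj jc]]; split=> //.
  by have [i im ij] := eP _ Xx _ xj; exists i; rewrite /= ?ij.
have [i il ix] := thP (x, q) (conj Xx Dq).
have s0E : s0 d i = (g d \o e x) @` q by rewrite /s0 ix image_comp.
exists i; first exact: lt_trans ld.
case: pselect => [h|[]]; rewrite /= s0E; first by move=> c /qA[].
by split; [exact: qc.1|exact: osup_cofinal].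
Qed.

(** The code [code a] of the pair (a, A below a) is injective in a, so the codes
    form a set of size tau to which the club principle applies. A set of codes
    cofinal in d decodes to initial segments of A; their union contains A below
    d as soon as, for all a < d, the codes of the ordinals up to a are bounded
    below d. *)
Lemma diamond_star_of_clubsuit_star (lam : Ord) (E : set Ord) :
  infinite_cardinal lam -> pow2 lam = succ_card lam ->
  clubsuit_star (succ_card lam) (ideal_restr (succ_card lam) (NS (succ_card lam)) E) ->
  diamond_star (succ_card lam) (ideal_restr (succ_card lam) (NS (succ_card lam)) E).
Proof.
move=> li pl [s [sP sG]]; set tau := succ_card lam in pl sP sG *.
have ti : infinite_cardinal tau := infinite_succ_card li.
have [g gP] := surjections_below_succ lam.
have /pcard_surjP[P PP] : [set x : set Ord | x `<=` seg lam] #<= seg tau.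
  by apply/ocard_leP; [apply: (@small_subsets _ lam)|rewrite -pl].
have /pcard_surjP[pr prP] := card_setX_self_le ti.2.
pose dec k := g (pr k).1 @` P (pr k).2.
exists (fun d i => seg d `&` \bigcup_(k in s d i) dec k); split.
  by move=> i d _ _ c [].
move=> A At.
have /choice[code codeP] : forall a, exists k, a < tau ->
    [/\ k < tau, (pr k).1 = a & dec k = A `&` seg a].
  move=> a; have [at'|] := pselect (a < tau); last by exists a.
  have [b bt bE] : (P @` seg tau) (seg lam `&` g a @^-1` (A `&` seg a)).
    by apply: PP => c [].
  have [k kt kE] := prP (a, b) (conj at' bt); exists k => _; rewrite /dec kE /= bE.
  split=> //; apply/seteqP; split=> [_ [c [_ ?] <-]//|c [Acc ca]].
  by have [i il ic] := gP _ at' _ ca; exists i => //; split; rewrite //= ic.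
have codeI : {in seg tau &, injective code}.
  move=> a b /set_mem/codeP[_ ea _] /set_mem/codeP[_ eb _] e.
  by rewrite -ea -eb e.
have codeA : subsets_eq tau (seg tau) (code @` seg tau).
  split; first by move=> _ [a /codeP[kt _ _] <-].
  by rewrite (ocard_congr (inj_card_eq codeI)); exact: ti.1.
have [|C1 C1c C1P] := (dual_filter_NS E _).1 (sG _ codeA); first by move=> d [].
apply/dual_filter_NS; first by move=> d [].
pose f a := Order.max (next_in C1 a) (code a).
exists (closure_points tau f).
  apply: club_closure_points => // a at'; rewrite gt_max.
  have [_ _ ->] := next_inP ti C1c.1 at'.
  by have [] := codeP _ at'.
move=> d [Cd Ed]; have [dt d0 dP] := Cd.
have C1d : C1 d.
  apply: (club_limit_mem C1c dt d0); apply: (closure_points_next ti C1c.1 Cd).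
  by move=> a _; rewrite le_max lexx.
have [_ dl [i id si]] := C1P _ (conj C1d Ed).
split=> //; exists i => //; have [sd so] := sP _ _ id dt dl.
apply/seteqP; split=> [c [cd [_ /si[a at' <-] ]]|c [Acc cd]].
  by have [_ _ ->] := codeP _ at' => -[Acc _].
split=> //; have [b /andP[cb bd] fb] := dP _ cd.
have [k sk bk] := unbounded_osup d0 sd so bd.
exists k => //; have [a at' ak] := si _ sk; move: bk; rewrite -ak => bk.
have [_ _ ->] := codeP _ at'; split=> //; rewrite /seg /= ltNge; apply/negP => ac.
have := lt_trans bk (le_lt_trans _ (fb _ ac)).
by rewrite le_max lexx orbT => /(_ isT); rewrite ltxx.
Qed.

Theorem proposition4p9 (mu lam : Ord)
    (mu_inf : infinite_cardinal mu) (lam_inf : infinite_cardinal lam)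
    (mu_reg : cf mu = mu) (mu_lt_lam : mu < lam)
    (rev : revision_cardinal lam (succ_card mu)) :
  [/\ clubsuit_cof (succ_card lam) (succ_card mu)
        (ideal_restr (succ_card lam) (NS (succ_card lam))
           (Ecf (succ_card lam) mu)),
      density mu mu <= lam ->
        clubsuit_star (succ_card lam)
          (ideal_restr (succ_card lam) (NS (succ_card lam))
             (Ecf (succ_card lam) mu))
    & density mu mu <= lam -> pow2 lam = succ_card lam ->
        diamond_star (succ_card lam)
          (ideal_restr (succ_card lam) (NS (succ_card lam))
             (Ecf (succ_card lam) mu))].
Proof.
have [X XL Xcov] := covering_family rev.
have star : density mu mu <= lam -> clubsuit_star (succ_card lam)
    (ideal_restr (succ_card lam) (NS (succ_card lam)) (Ecf (succ_card lam) mu)).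
  move=> dl; have [D Dc Dd] := dense_family mu.
  apply: (clubsuit_star_of_covering lam_inf mu_inf.1 XL Xcov _ Dd).
  exact: card_le_trans Dc (card_le_seg dl).
split=> //; first exact: clubsuit_cof_of_covering XL Xcov.
by move=> dl pl; apply: diamond_star_of_clubsuit_star => //; exact: star.
Qed.
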